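(* Let $d\geq 0$ and $k\geq 2$ be integers. For every function $f\colon\mathbb{Z}^d\to\mathbb{C}$ supported in $\{0,1\}^d$, the inequality \[ \|f\|_{\mathrm{U}^k} \leq \|f\|_{\ell^p} \] holds for every exponent $p$ with \[ 0 < p \leq \frac{2^k}{\log_2(2k+2)}. \] In particular, \[ P_k(A) \leq |A|^{\log_2(2k+2)} \] holds for every set $A\subseteq\{0,1\}^d$.
   Context: For $p\in(0,\infty)$ and a finitely supported function $f\colon\mathbb{Z}^d\to\mathbb{C}$, $\|f\|_{\ell^p} := \big(\sum_{x\in\mathbb{Z}^d}|f(x)|^p\big)^{1/p}$. The Gowers uniformity norm of a finitely supported $f\colon\mathbb{Z}^d\to\mathbb{C}$ is \[ \|f\|_{\mathrm{U}^k} := \bigg( \sum_{a,h_1,\ldots,h_k\in\mathbb{Z}^d}\ \prod_{(\epsilon_1,\ldots,\epsilon_k)\in\{0,1\}^k} \mathcal{C}^{\epsilon_1+\cdots+\epsilon_k} f(a+\epsilon_1 h_1+\cdots+\epsilon_k h_k) \bigg)^{1/2^k}, \] where $\mathcal{C}\colon z\mapsto\bar z$ is complex conjugation. For a finite set $A\subset\mathbb{Z}^d$, \[ P_k(A) := \big|\big\{(a,h_1,\ldots,h_k)\in(\mathbb{Z}^d)^{k+1} : a+\epsilon_1h_1+\cdots+\epsilon_kh_k\in A \text{ for every } (\epsilon_1,\ldots,\epsilon_k)\in\{0,1\}^k\big\}\big|. \] The group $\mathbb{Z}^0$ is the trivial group consisting only of the neutral element, and $\{0,1\}^0=\mathbb{Z}^0$.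 *)

(* Defs.v *)
From HB Require Import structures.
From mathcomp Require Import all_boot all_order all_algebra finmap.
From mathcomp Require Import all_classical all_reals all_analysis.
From mathcomp Require Import complex.

Set Implicit Arguments.
Unset Strict Implicit.
Unset Printing Implicit Defensive.

Import Order.TTheory GRing.Theory Num.Theory.

Local Open Scope classical_set_scope.
Local Open Scope ring_scope.

(* Z^d is 'rV[int]_d, a one-point group when d = 0. A tuple (a, h_1, ..., h_k)
   is a pair (a, h) with h : {ffun 'I_k -> 'rV[int]_d}, and {0,1}^k is
   {ffun 'I_k -> bool}, the coercion bool >-> nat giving the value of eps i. *)

Definition cube (d : nat) : set 'rV[int]_d :=
  [set x : 'rV[int]_d | forall j : 'I_d, x ord0 j = 0 \/ x ord0 j = 1].

Definition vertex (d k : nat) (ah : 'rV[int]_d * {ffun 'I_k -> 'rV[int]_d})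
    (eps : {ffun 'I_k -> bool}) : 'rV[int]_d :=
  ah.1 + \sum_(i < k) ah.2 i *+ eps i.

(* Sums \sum_(i \in setT) are over the support of the summand, which has to be
   finite; this is the case below when f is finitely supported and, for
   lp_norm, p > 0. *)

Definition lp_norm (R : realType) (d : nat) (p : R) (f : 'rV[int]_d -> R[i])
    : R :=
  (\sum_(x \in [set: 'rV[int]_d]) ComplexField.Normc.normc (f x) `^ p) `^ p^-1.

Definition gowers_sum (R : realType) (d k : nat) (f : 'rV[int]_d -> R[i])
    : R[i] :=
  \sum_(ah \in [set: 'rV[int]_d * {ffun 'I_k -> 'rV[int]_d}])
    \prod_(eps : {ffun 'I_k -> bool})
      iter (\sum_(i < k) eps i)%N (@conjc R) (f (vertex ah eps)).

(* For k >= 1 the sum is a nonnegative real number, so taking its real part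
   only changes its type. *)
Definition gowers_norm (R : realType) (d k : nat) (f : 'rV[int]_d -> R[i])
    : R :=
  complex.Re (gowers_sum k f) `^ (2 ^+ k)^-1.

(* fset_set is the empty set on infinite sets, but the set below is finite:
   it injects into A ^ (k + 1) through (a, a + h_1, ..., a + h_k). *)
Definition parallelepipeds (d k : nat) (A : {fset 'rV[int]_d}) : nat :=
  #|` fset_set [set ah : 'rV[int]_d * {ffun 'I_k -> 'rV[int]_d} |
                 forall eps, vertex ah eps \in A] |.

Definition log2 (R : realType) (x : R) : R := ln x / ln 2.

(* Main.v *)
Require Import Defs.
From mathcomp Require Import all_boot all_order all_algebra finmap.
From mathcomp Require Import all_classical all_reals all_analysis.
From mathcomp Require Import complex zify ring lra.
Import Order.TTheory GRing.Theory Num.Theory.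
Import numFieldNormedType.Exports.
Local Open Scope classical_set_scope.
Local Open Scope ring_scope.

Set Implicit Arguments.
Unset Strict Implicit.
Unset Printing Implicit Defensive.

(** The inequality tensorizes: it is proved by induction on d, and the induction
    step is an inequality between two nonnegative reals.

    In one coordinate, the vertices of a parallelepiped (a, h_1, ..., h_k) are
    all 0 or 1 exactly when a is 0 or 1, at most one h_i is nonzero, and that h_i
    is 1 - 2 a. Such a coordinate is encoded by a letter (b, o): the base bit b,
    and the direction o that moves it, or None. There are 2 (k + 1) letters,
    which is where 2 k + 2 comes from. A parallelepiped in {0,1}^d is a word of d
    letters, and the infinite sum defining the Gowers norm becomes a finite sum
    over words (gowers_sum_word_sum).

    Let f be supported in {0,1}^(d+1), and let f_0, f_1 be its restrictions to
    the two layers given by the first coordinate. Sorting the words by their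
    first letter (word_sum_cons), a letter (c, None) contributes
    ||f_c||^(2^k), with ||.|| the U^k norm, and a letter (c, Some i)
    contributes a sum in which f_c sits on the vertices with eps_i = 0 and
    f_(1-c) on those with eps_i = 1. This mixed sum is a positive semidefinite
    hermitian form in the products of f_c and f_(1-c) over the two faces
    (mixed_sum_hermitian), so by Cauchy-Schwarz it is at most
    ||f_0||^(2^(k-1)) ||f_1||^(2^(k-1)). Put q = 2^k / p, let s and t be the sums
    of |f_0|^p and |f_1|^p, and use the induction hypothesis
    ||f_0||^(2^k) <= s^q and ||f_1||^(2^k) <= t^q; it remains to see that
      s^q + t^q + 2 k (s t)^(q/2) <= (s + t)^q.
    The bound on p says that 2 k <= 2^q - 2, so this follows from two_point, in
    which 2 k is replaced by 2^q - 2, with equality at s = t. With w = t / s, the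
    latter says that ((1 + w)^q - 1 - w^q) w^(-q/2) is at least its value at
    w = 1; this function is nonincreasing on ]0, 1] because q >= 2.

    The bound on P_k(A) is the case of an indicator function. *)

(** * The two-point inequality *)

Lemma powR_ge1Dln (R : realType) (x r : R) : 0 < x -> 1 + r * ln x <= x `^ r.
Proof. by move=> x0; rewrite /powR gt_eqF// expR_ge1Dx. Qed.

Lemma ln_ge1B (R : realType) (x : R) : 0 < x -> 1 - x^-1 <= ln x.
Proof.
move=> x0; have xV0 : 0 < x^-1 by rewrite invr_gt0.
have := @le_ln1Dx R (x^-1 - 1).
by rewrite addrCA subrr addr0 lnV ?posrE// => /(_ ltac:(lra)); lra.
Qed.

(** As a function of q, the right side minus the left is a nonnegative
    combination of exponentials minus 1, hence convex, and it vanishes at q = 1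
    and q = 2; so it is nonnegative from 2 on. The proof bounds it below by its
    tangent at q = 2, whose slope (1 - w^2) ln (1 + w) + w^2 ln w is nonnegative
    by ln x >= 1 - 1/x. *)
Lemma derivative_sign (R : realType) (q w : R) : 2 <= q -> 0 < w <= 1 ->
  1 - w `^ q <= (1 + w) `^ (q - 1) * (1 - w).
Proof.
move=> q2 /andP[w0 w1].
have w1p : 0 < 1 + w by lra.
have split2 (x : R) (e n : R) : 0 < x -> x `^ (e + n) = x `^ e * x `^ n.
  by move=> x0; rewrite powRD// (gt_eqF x0) implybT.
have -> : q - 1 = 1 + (q - 2) by ring.
have -> : w `^ q = w `^ 2 * w `^ (q - 2) by rewrite -split2//; congr powR; ring.
rewrite (split2 (1 + w))// powRr1 ?(ltW w1p)// powR_mulrn ?(ltW w0)//.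
have B1 := powR_ge1Dln (q - 2) w1p; have B2 := powR_ge1Dln (q - 2) w0.
have L1 := ln_ge1B w1p; have L2 := ln_ge1B w0.
(* The slope of the tangent at q = 2. *)
have K : 0 <= (1 - w ^+ 2) * ln (1 + w) + w ^+ 2 * ln w.
  have K1 : 0 <= (1 - w ^+ 2) * (ln (1 + w) - (1 - (1 + w)^-1)).
    by apply: mulr_ge0; [nra|lra].
  have K2 : 0 <= w ^+ 2 * (ln w - (1 - w^-1)) by apply: mulr_ge0; [nra|lra].
  have : (1 - w ^+ 2) * (1 - (1 + w)^-1) + w ^+ 2 * (1 - w^-1) = 0.
    by field; rewrite !gt_eqF.
  lra.
have P1 : 0 <= (1 - w ^+ 2) * ((1 + w) `^ (q - 2) - (1 + (q - 2) * ln (1 + w))).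
  by apply: mulr_ge0; [nra|lra].
have P2 : 0 <= w ^+ 2 * (w `^ (q - 2) - (1 + (q - 2) * ln w)).
  by apply: mulr_ge0; [nra|lra].
have P3 : 0 <= (q - 2) * ((1 - w ^+ 2) * ln (1 + w) + w ^+ 2 * ln w).
  by rewrite mulr_ge0// subr_ge0.
lra.
Qed.

(** Divided by w^(q/2), the inequality says f 1 <= f w for the function f of the
    proof; up to a positive factor, derivative_sign says that f' <= 0. *)
Lemma two_point1 (R : realType) (q w : R) : 2 <= q -> 0 < w <= 1 ->
  1 + w `^ q + (2 `^ q - 2) * w `^ (q / 2) <= (1 + w) `^ q.
Proof.
move=> q2 /andP[w0 w1].
pose f (y : R) := ((1 + y) `^ q - 1 - y `^ q) * y `^ (- (q / 2)).
pose df (y : R) := ((q * (1 + y) `^ (q - 1)) - (q * y `^ (q - 1))) * y `^ (- (q / 2))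
   + ((1 + y) `^ q - 1 - y `^ q) * (- (q / 2) * y `^ (- (q / 2) - 1)).
have der (y : R) : 0 < y -> is_derive y 1 f (df y).
  move=> y0.
  have y1 : 0 < 1 + y by lra.
  have D1 : is_derive y 1 (fun z : R => (1 + z) `^ q) (q * (1 + y) `^ (q - 1)).
    have /= := @is_derive1_comp R (@powR R ^~ q) (fun z : R => 1 + z) y
      (q * (1 + y) `^ (q - 1)) 1.
    rewrite mulr1; apply; first exact: is_derive1_powR.
    rewrite -[X in is_derive _ _ _ X]add0r.
    exact: (is_deriveD (is_derive_cst (1 : R) y 1) (is_derive_id y 1)).
  have D2 := @is_derive1_powR R q _ y0.
  have D3 := @is_derive1_powR R (- (q / 2)) _ y0.
  rewrite /f; apply: is_derive_eq.
  rewrite /df subr0 /GRing.scale/=; ring.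
have dfle0 (y : R) : 0 < y <= 1 -> df y <= 0.
  move=> /andP[y0 y1].
  have := derivative_sign q2 (introT andP (conj y0 y1)).
  have sp (x e : R) : 0 < x -> x `^ e = x `^ (e - 1) * x.
    by move=> x0; rewrite -{3}[x]powRr1 ?ltW// -powRD ?subrK// (gt_eqF x0) implybT.
  have y1p : 0 < 1 + y by lra.
  rewrite /df (sp (1 + y) q)// (sp y q)// (sp y (- (q/2)))//.
  have := powR_gt0 (- (q/2) - 1) y0.
  move: (y `^ (- (q / 2) - 1)) ((1 + y) `^ (q - 1)) (y `^ (q - 1)) => a b c a0 h.
  have -> : (q * b - q * c) * (a * y) + (b * (1 + y) - 1 - c * y) * (- (q / 2) * a)
    = (q / 2) * a * ((1 - c * y) - b * (1 - y)) by field.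
  by rewrite mulr_ge0_le0 ?mulr_ge0 ?subr_le0//; lra.
have f1 : f 1 = 2 `^ q - 2 by rewrite /f !powR1 mulr1 (_ : 1 + 1 = 2 :> R) //; ring.
have fw : 2 `^ q - 2 <= f w.
  have [//||c] := @MVT_segment R f df w 1 w1.
  - by move=> y; rewrite in_itv/= => /andP[wy _]; apply: der; lra.
  - apply: continuous_in_subspaceT => y; rewrite inE/= in_itv/= => /andP[wy _].
    apply: differentiable_continuous; apply/derivable1_diffP.
    by apply: ex_derive; apply: der; lra.
  - rewrite in_itv/= => /andP[wc c1] E.
    have : df c * (1 - w) <= 0.
      by rewrite mulr_le0_ge0 ?subr_ge0//; apply: dfle0; apply/andP; split; lra.
    by rewrite -E f1; lra.
have p0 := powR_gt0 (q / 2) w0.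
move: fw; rewrite /f powRN ler_pdivlMr// => fw; lra.
Qed.

(** Homogeneity and symmetry reduce this to w = t / s in two_point1. *)
Lemma two_point (R : realType) (q s t : R) : 2 <= q -> 0 <= s -> 0 <= t ->
  s `^ q + t `^ q + (2 `^ q - 2) * (s `^ (q / 2) * t `^ (q / 2))
    <= (s + t) `^ q.
Proof.
move=> q2; wlog ts : s t / t <= s.
  move=> H s0 t0; have [/H|/ltW/H] := leP t s; first exact.
  by rewrite (addrC s) (addrC (s `^ q)) (mulrC (s `^ (q/2))); apply.
move=> s0; rewrite le_eqVlt => /predU1P[<-|t0].
  by rewrite !powR0 ?mulr0 ?addr0//; apply/eqP; lra.
have {}s0 : 0 < s by lra.
have w01 : 0 < t / s <= 1 by rewrite divr_gt0//= ler_pdivrMr// mul1r.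
have /(ler_wpM2l (powR_ge0 s q)) := two_point1 q2 w01.
have w0 : 0 <= t / s by rewrite divr_ge0 ?ltW.
have tE : t = s * (t / s) by rewrite mulrC divfK// gt_eqF.
have -> : s + t = s * (1 + t / s) by rewrite mulrDr mulr1 -tE.
rewrite [X in _ -> _ <= X]powRM ?(ltW s0) ?addr_ge0//; congr (_ <= _).
rewrite !mulrDr mulr1 -[s `^ q * (t / s) `^ q]powRM ?(ltW s0)// -tE; congr (_ + _).
rewrite mulrCA [in t `^ _]tE [(s * _) `^ _]powRM ?(ltW s0)//.
congr (_ * _); rewrite [RHS]mulrA -powRD; last by rewrite (gt_eqF s0) implybT.
by rewrite -splitr.
Qed.

(** * Words *)

Notation point d := {ffun 'I_d -> bool}.
(** The letter (b, o) stands for the function eps |-> b (+) eps_i if o = Some i,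
    and for the constant b if o = None: these are the 2 k + 2 restrictions of
    parallelepipeds to one coordinate. *)
Notation letter k := (bool * option 'I_k)%type.
Notation word d k := {ffun 'I_d -> letter k}.

Definition letter_at (k : nat) (l : letter k) (e : point k) : bool :=
  l.1 (+) (if l.2 is Some i then e i else false).

Definition word_at (d k : nat) (w : word d k)
    (e : point k) : point d :=
  [ffun j => letter_at (w j) e].

Definition conj_at (R : realType) (k : nat) (e : point k)
    (z : R[i]) : R[i] :=
  iter (\sum_(i < k) e i)%N (@conjc R) z.

Definition word_sum (R : realType) (d k : nat)
    (f : point d -> R[i]) : R[i] :=
  \sum_(w : word d k)
    \prod_(e : point k) conj_at e (f (word_at w e)).

(** The Gowers inner product of the family equal to h on the face eps_i = 1 and
    to g on the opposite face. *)
Definition mixed_sum (R : realType) (d k : nat) (i : 'I_k)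
    (g h : point d -> R[i]) : R[i] :=
  \sum_(w : word d k)
    \prod_(e : point k)
      conj_at e ((if e i then h else g) (word_at w e)).

Lemma mixed_sum_diag (R : realType) (d k : nat) (i : 'I_k)
    (f : point d -> R[i]) :
  mixed_sum i f f = word_sum k f.
Proof.
by apply: eq_bigr => w _; apply: eq_bigr => e _; rewrite if_same.
Qed.

(** * Cauchy-Schwarz in one direction *)

Definition flip (k : nat) (i : 'I_k) (e : point k) :
    point k :=
  [ffun j => e j (+) (j == i)].

Lemma flipK (k : nat) (i : 'I_k) : involutive (flip i).
Proof. by move=> e; apply/ffunP => j; rewrite !ffunE addbK. Qed.

Lemma conj_at_flip (R : realType) (k : nat) (i : 'I_k)
    (e : point k) (z : R[i]) : ~~ e i ->
  conj_at (flip i e) z = conjc (conj_at e z).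
Proof.
move=> /negbTE ei; rewrite /conj_at (bigD1 i)//= [in RHS](bigD1 i)//=.
rewrite ffunE ei eqxx add0n /=; congr (conjc (iter _ _ _)).
by apply: eq_bigr => j /negbTE ji; rewrite ffunE ji addbF.
Qed.

(** Cutting a parallelepiped by eps_i = c gives a parallelepiped in the other
    directions: coordinates moved by eps_i freeze, at their value for eps_i = c.
    Both faces are words in which i does not occur. *)
Definition letter_face (k : nat) (i : 'I_k) (c : bool) (l : letter k) :
    letter k :=
  if l.2 == Some i then (l.1 (+) c, None) else l.

Definition face (d k : nat) (i : 'I_k) (c : bool) (w : word d k) :
    word d k :=
  [ffun j => letter_face i c (w j)].

Lemma word_at_face (d k : nat) (i : 'I_k) (w : word d k) e :
  word_at w e = word_at (face i (e i) w) e.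
Proof.
apply/ffunP => j; rewrite !ffunE /letter_face /letter_at.
by case: (w j) => b [i'|]//=; case: eqP => // -[->]; rewrite addbF.
Qed.

Lemma word_at_face_flip (d k : nat) (i : 'I_k) c (w : word d k) e :
  word_at (face i c w) (flip i e) = word_at (face i c w) e.
Proof.
apply/ffunP => j; rewrite !ffunE /letter_face /letter_at.
case: (w j) => b [i'|]//=; case: eqP => //= ni; rewrite ffunE.
by case: eqP => [ii|]; rewrite ?addbF//; case: ni; rewrite ii.
Qed.

Definition face_prod (R : realType) (d k : nat) (i : 'I_k)
    (g : point d -> R[i]) (w : word d k) : R[i] :=
  \prod_(e : point k | ~~ e i) conj_at e (g (word_at w e)).

Lemma mixed_sum_faces (R : realType) (d k : nat) (i : 'I_k)
    (g h : point d -> R[i]) :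
  mixed_sum i g h =
  \sum_(w : word d k)
    face_prod i g (face i false w) * conjc (face_prod i h (face i true w)).
Proof.
apply: eq_bigr => w _; rewrite (bigID (fun e : point k => ~~ e i))/=.
congr (_ * _).
  apply: eq_bigr => e /negbTE ei.
  by rewrite ei (word_at_face i) ei.
rewrite rmorph_prod (reindex_inj (inv_inj (flipK i)))/=.
apply: eq_big => [e|e]; rewrite ffunE eqxx addbT negbK// => ei.
rewrite ei conj_at_flip// (word_at_face i) ffunE (negbTE ei) eqxx.
by rewrite word_at_face_flip.
Qed.

(** Encodes the increments h_i of a coordinate, forgetting its base point. When
    the coordinate is moved by some eps_i, the sign of h_i determines the base
    bit, which is therefore kept; when it is constant, the base bit is free. *)
Definition letter_dir (k : nat) (l : letter k) : letter k :=
  if l.2 is None then (false, None) else l.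

Definition dir (d k : nat) (w : word d k) :
    word d k := [ffun j => letter_dir (w j)].

Definition avoids (d k : nat) (i : 'I_k) (w : word d k) : bool :=
  [forall j, (w j).2 != Some i].

(** Two parallel letters without i differ only if they are the two constants;
    then they are the faces of a letter moved by eps_i. *)
Definition letter_glue (k : nat) (i : 'I_k) (l0 l1 : letter k) : letter k :=
  if l0 == l1 then l0 else (l0.1, Some i).

Lemma letter_glueK (k : nat) (i : 'I_k) (l0 l1 : letter k) (c : bool) :
  l0.2 != Some i -> l1.2 != Some i -> letter_dir l0 = letter_dir l1 ->
  letter_face i c (letter_glue i l0 l1) = if c then l1 else l0.
Proof.
rewrite /letter_face /letter_glue /letter_dir.
case: l0 => b0 [i0|]; case: l1 => b1 [i1|] //=.
- by move=> /negbTE n0 _ [<- <-]; rewrite eqxx /= n0 if_same.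
- by case: b0 b1 c => [] [] [] _ _ _ /=; rewrite ?eqxx.
Qed.

Lemma letter_faceK (k : nat) (i : 'I_k) (l : letter k) :
  letter_glue i (letter_face i false l) (letter_face i true l) = l.
Proof.
rewrite /letter_glue /letter_face; case: l => b o /=.
have [->|_] := eqVneq o (Some i); last by rewrite eqxx.
by rewrite xpair_eqE; case: b.
Qed.

(** Two parallelepipeds without direction i are opposite faces of a
    parallelepiped exactly when they are translates of each other, and they
    determine it. So a sum over parallelepipeds is a sum over the common
    directions u of the two faces, and then over independent faces w0, w1. *)
Lemma sum_faces (V : nmodType) (d k : nat) (i : 'I_k)
    (F : word d k -> word d k -> V) :
  \sum_(w : word d k) F (face i false w) (face i true w) =
  \sum_(u : word d k)
    \sum_(w0 : word d k | avoids i w0 && (dir w0 == u))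
      \sum_(w1 : word d k | avoids i w1 && (dir w1 == u)) F w0 w1.
Proof.
pose W := word d k.
pose P (p : W * W) := [&& avoids i p.1, avoids i p.2 & dir p.1 == dir p.2].
transitivity (\sum_(p : W * W | P p) F p.1 p.2).
  pose glue (p : W * W) : W := [ffun j => letter_glue i (p.1 j) (p.2 j)].
  rewrite (reindex_onto (fun w : W => (face i false w, face i true w)) glue).
    apply: eq_bigl => w /=; apply/esym/andP; split; last first.
      by apply/eqP/ffunP => j; rewrite !ffunE letter_faceK.
    apply/and3P; split; first 2 last.
    - apply/eqP/ffunP => j; rewrite !ffunE /letter_face /letter_dir.
      by case: eqP.
    - apply/forallP => j; rewrite ffunE /letter_face.
      by case: ifPn.
    - apply/forallP => j; rewrite ffunE /letter_face.
      by case: ifPn.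
  move=> [w0 w1] /and3P[/forallP f0 /forallP f1 /eqP/ffunP d01] /=.
  congr (_, _); apply/ffunP => j; move: (d01 j); rewrite !ffunE => dj;
    exact: letter_glueK.
rewrite (partition_big (fun p : W * W => dir p.1) predT)//=.
apply: eq_bigr => u _; rewrite pair_big/=; apply: eq_bigl => -[w0 w1] /=.
rewrite /P/=; apply/idP/idP.
  by move=> /andP[/and3P[-> -> /eqP<-] /eqP->]; rewrite eqxx.
by move=> /andP[/andP[-> /eqP->] /andP[-> /eqP->]]; rewrite eqxx.
Qed.

Definition dir_sum (R : realType) (d k : nat) (i : 'I_k)
    (g : point d -> R[i]) (u : word d k) : R[i] :=
  \sum_(w : word d k | avoids i w && (dir w == u)) face_prod i g w.

(** Once the two faces are independent, the sum over them factors; the second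
    factor is conjugated because eps_i = 1 adds one conjugation. *)
Lemma mixed_sum_hermitian (R : realType) (d k : nat) (i : 'I_k)
    (g h : point d -> R[i]) :
  mixed_sum i g h =
  \sum_(u : word d k) dir_sum i g u * conjc (dir_sum i h u).
Proof.
rewrite mixed_sum_faces.
rewrite (sum_faces i (fun w0 w1 => face_prod i g w0 * conjc (face_prod i h w1))).
apply: eq_bigr => u _; rewrite rmorph_sum big_distrl/=.
by apply: eq_bigr => w0 _; rewrite big_distrr.
Qed.

(** Lagrange's identity: twice the difference of the two sides is the sum of the
    squares (x_i y_j - x_j y_i)^2. *)
Lemma sum_CauchySchwarz (R : realDomainType) (I : finType) (x y : I -> R) :
  (\sum_i x i * y i) ^+ 2 <= (\sum_i x i ^+ 2) * (\sum_i y i ^+ 2).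
Proof.
have : 0 <= \sum_i \sum_j (x i * y j - x j * y i) ^+ 2.
  by do 2!apply: sumr_ge0 => ? _; exact: sqr_ge0.
suff -> : \sum_i \sum_j (x i * y j - x j * y i) ^+ 2 =
    ((\sum_i x i ^+ 2) * (\sum_i y i ^+ 2) - (\sum_i x i * y i) ^+ 2) *+ 2.
  by rewrite pmulrn_lge0// subr_ge0.
rewrite mulrnBl mulr2n {2}[_ * (\sum_i y i ^+ 2)]mulrC expr2 !big_distrlr/=.
rewrite -sumrMnl -big_split -sumrB/=; apply: eq_bigr => i _.
rewrite -sumrMnl -big_split -sumrB/=; apply: eq_bigr => j _.
by ring.
Qed.

Lemma Re_sum_CauchySchwarz (R : realType) (I : finType) (a b : I -> R[i]) :
  complex.Re (\sum_i a i * conjc (b i)) ^+ 2 <=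
  complex.Re (\sum_i a i * conjc (a i)) * complex.Re (\sum_i b i * conjc (b i)).
Proof.
pose coord (z : R[i]) (c : bool) := if c then complex.Im z else complex.Re z.
have ReE (f g : I -> R[i]) : complex.Re (\sum_i f i * conjc (g i)) =
    \sum_(p : I * bool) coord (f p.1) p.2 * coord (g p.1) p.2.
  rewrite -(pair_bigA _ (fun i c => coord (f i) c * coord (g i) c))/=.
  rewrite raddf_sum; apply: eq_bigr => i _; rewrite big_bool /=.
  by case: (f i) (g i) => [x y] [u v] /=; ring.
rewrite !ReE; under [X in _ <= X * _]eq_bigr do rewrite -expr2.
under [X in _ <= _ * X]eq_bigr do rewrite -expr2.
exact: sum_CauchySchwarz.
Qed.

(** A word sum is the diagonal value of the form of mixed_sum_hermitian, which
    takes a direction i, hence k > 0. *)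
Lemma Re_word_sum_ge0 (R : realType) (d k : nat) (i : 'I_k)
    (f : point d -> R[i]) : 0 <= complex.Re (word_sum k f).
Proof.
rewrite -(mixed_sum_diag i) mixed_sum_hermitian raddf_sum sumr_ge0// => u _ /=.
by case: (dir_sum i f u) => x y /=; nra.
Qed.

Lemma mixed_sum_CauchySchwarz (R : realType) (d k : nat) (i : 'I_k)
    (g h : point d -> R[i]) :
  complex.Re (mixed_sum i g h) ^+ 2 <=
  complex.Re (word_sum k g) * complex.Re (word_sum k h).
Proof.
rewrite -!(mixed_sum_diag i) !mixed_sum_hermitian.
exact: Re_sum_CauchySchwarz.
Qed.

(** * Induction on the dimension *)

Definition fcons (T : Type) (d : nat) (x : T) (v : {ffun 'I_d -> T}) :
    {ffun 'I_d.+1 -> T} := [ffun j => oapp v x (unlift ord0 j)].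

Lemma sum_fcons (V : nmodType) (T : finType) (d : nat)
    (F : {ffun 'I_d.+1 -> T} -> V) :
  \sum_(w : {ffun 'I_d.+1 -> T}) F w =
  \sum_(x : T) \sum_(v : {ffun 'I_d -> T}) F (fcons x v).
Proof.
rewrite pair_bigA/= (reindex (fun p : T * {ffun 'I_d -> T} => fcons p.1 p.2))//.
exists (fun w : {ffun 'I_d.+1 -> T} => (w ord0, [ffun j => w (lift ord0 j)])).
  move=> [x v] _; rewrite ffunE unlift_none/=; congr (_, _).
  by apply/ffunP => j; rewrite !ffunE liftK.
move=> w _; apply/ffunP => j; rewrite ffunE/=.
by case: (unliftP ord0 j) => [i|] ->; rewrite /= ?ffunE.
Qed.

Lemma word_at_cons (d k : nat) (l : letter k) (w : word d k) (e : point k) :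
  word_at (fcons l w) e = fcons (letter_at l e) (word_at w e).
Proof.
by apply/ffunP => j; rewrite !ffunE; case: unlift => //= i; rewrite ffunE.
Qed.

Lemma sum_option (V : nmodType) (T : finType) (F : option T -> V) :
  \sum_o F o = F None + \sum_x F (Some x).
Proof.
rewrite (bigD1 None)//=; congr (_ + _).
by rewrite (reindex_omap Some id) => [|[x|]]//=; apply: eq_bigl => x; rewrite eqxx.
Qed.

Definition layer (T : Type) (d : nat) (f : point d.+1 -> T) (c : bool) :
    point d -> T := fun x => f (fcons c x).

(** The first letter decides which layer of f is used at each vertex: always the
    layer c for (c, None), and the layer c (+) eps_i for (c, Some i). *)
Lemma word_sum_cons (R : realType) (d k : nat) (f : point d.+1 -> R[i]) :
  word_sum k f =
  \sum_(c : bool) (word_sum k (layer f c) +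
    \sum_(i < k) mixed_sum i (layer f c) (layer f (~~ c))).
Proof.
rewrite /word_sum sum_fcons.
transitivity (\sum_(c : bool) \sum_(o : option 'I_k) \sum_(w : word d k)
    \prod_(e : point k) conj_at e (f (word_at (fcons (c, o) w) e))).
  by rewrite [RHS]pair_bigA; apply: eq_bigr => -[].
apply: eq_bigr => c _; rewrite sum_option; congr (_ + _).
  apply: eq_bigr => w _; apply: eq_bigr => e _.
  by rewrite word_at_cons /letter_at/= addbF.
apply: eq_bigr => i _; apply: eq_bigr => w _; apply: eq_bigr => e _.
by rewrite word_at_cons /letter_at/=; case: (e i); rewrite ?addbT ?addbF.
Qed.

Lemma normc_conj_at (R : realType) (k : nat) (e : point k) (z : R[i]) :
  ComplexField.Normc.normc (conj_at e z) = ComplexField.Normc.normc z.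
Proof.
rewrite /conj_at; elim: (\sum_(i < k) e i)%N => //= n <-.
by case: (iter _ _ _) => a b /=; rewrite sqrrN.
Qed.

Lemma Re_le_normc (R : realType) (z : R[i]) :
  complex.Re z <= ComplexField.Normc.normc z.
Proof.
case: z => a b /=; apply: le_trans (ler_norm a) _; rewrite -sqrtr_sqr.
by rewrite ler_wsqrtr// lerDl sqr_ge0.
Qed.

Lemma sum_ffun_ord0 (V : nmodType) (T : finType) (F : {ffun 'I_0 -> T} -> V) :
  \sum_(v : {ffun 'I_0 -> T}) F v = F (ffun0 (card_ord 0)).
Proof.
by apply: big_pred1 => v; apply/esym/eqP/ffunP => -[].
Qed.

Lemma Re_word_sum_dim0 (R : realType) (k : nat) (f : point 0 -> R[i]) :
  complex.Re (word_sum k f) <=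
  ComplexField.Normc.normc (f (ffun0 (card_ord 0))) ^+ (2 ^ k).
Proof.
rewrite /word_sum sum_ffun_ord0; apply: le_trans (Re_le_normc _) _.
rewrite (big_morph _ (@ComplexField.Normc.normcM R) (@ComplexField.Normc.normc1 R)).
under eq_bigr do rewrite normc_conj_at.
rewrite (eq_bigr (fun=> ComplexField.Normc.normc (f (ffun0 (card_ord 0))))).
  by rewrite prodr_const card_ffun card_bool card_ord.
by move=> e _; congr (ComplexField.Normc.normc (f _)); apply/ffunP => -[].
Qed.

Lemma Re_word_sum_cons (R : realType) (d k : nat) (f : point d.+1 -> R[i]) :
  complex.Re (word_sum k f) =
  \sum_(c : bool) (complex.Re (word_sum k (layer f c)) +
    \sum_(i < k) complex.Re (mixed_sum i (layer f c) (layer f (~~ c)))).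
Proof.
rewrite word_sum_cons raddf_sum; apply: eq_bigr => c _.
by rewrite raddfD; congr (_ + _); exact: raddf_sum.
Qed.

(** Induction on d. The case d = 0 is an equality up to taking the real part:
    f has one value, which occurs at all 2^k vertices. *)
Lemma Re_word_sum_le (R : realType) (d k : nat) (i0 : 'I_k) (p q : R)
    (f : point d -> R[i]) : p * q = 2 ^+ k -> 2 <= q -> 2 * k%:R + 2 <= 2 `^ q ->
  complex.Re (word_sum k f) <=
  (\sum_(x : point d) ComplexField.Normc.normc (f x) `^ p) `^ q.
Proof.
move=> pq q2 hkq; elim: d f => [|d IH] f.
  rewrite sum_ffun_ord0 -powRrM pq -natrX powR_mulrn ?Re_word_sum_dim0//.
  by case: (f _) => a b; exact: sqrtr_ge0.
pose s c := \sum_(x : point d) ComplexField.Normc.normc (layer f c x) `^ p.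
pose S c := complex.Re (word_sum k (layer f c)).
have s0 c : 0 <= s c by apply: sumr_ge0 => x _; exact: powR_ge0.
have S0 c : 0 <= S c by exact: Re_word_sum_ge0.
have Ss c : S c <= s c `^ q by exact: IH.
pose m := s true `^ (q / 2) * s false `^ (q / 2).
have m0 : 0 <= m by rewrite mulr_ge0 ?powR_ge0.
have half (x : R) : (x `^ (q / 2)) ^+ 2 = x `^ q.
  by rewrite -powR_mulrn ?powR_ge0// -powRrM divfK.
have sqM (x y : R) : (x `^ (q / 2) * y `^ (q / 2)) ^+ 2 = x `^ q * y `^ q.
  by rewrite exprMn !half.
have mm : m ^+ 2 = s true `^ q * s false `^ q by exact: sqM.
have mixed c (i : 'I_k) : complex.Re (mixed_sum i (layer f c) (layer f (~~ c))) <= m.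
  apply: le_trans (ler_norm _) _; rewrite -ler_sqr ?nnegrE// real_normK ?num_real//.
  apply: le_trans (mixed_sum_CauchySchwarz _ _ _) _; rewrite mm.
  have SS := @ler_pM R _ _ _ _ (S0 true) (S0 false) (Ss true) (Ss false).
  by case: c; [exact: SS|rewrite [leLHS]mulrC; exact: SS].
have mixedk c : \sum_(i < k)
    complex.Re (mixed_sum i (layer f c) (layer f (~~ c))) <= k%:R * m.
  apply: le_trans (ler_sum _ (fun i _ => mixed c i)) _.
  by rewrite sumr_const card_ord mulr_natl.
rewrite Re_word_sum_cons sum_fcons !big_bool.
apply: le_trans (two_point q2 (s0 true) (s0 false)).
have fin (S1 S2 M1 M2 a b c n u : R) : S1 <= a -> M1 <= n * u -> S2 <= b ->
    M2 <= n * u -> 0 <= (c - (2 * n + 2)) * u ->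
    (S1 + M1) + (S2 + M2) <= a + b + (c - 2) * u.
  by clear; lra.
apply: fin (Ss true) (mixedk true) (Ss false) (mixedk false) _.
by rewrite mulr_ge0// subr_ge0.
Qed.

(** * From parallelepipeds of integer points to words *)

Lemma fsbig_inj (V : nmodType) (W : finType) (J : choiceType) (h : W -> J)
    (F : J -> V) :
  injective h -> (forall j, (forall w, h w <> j) -> F j = 0) ->
  \sum_(j \in [set: J]) F j = \sum_(w : W) F (h w).
Proof.
move=> h_inj F0.
rewrite -(fsbig_widen (range h))//; last first.
  by move=> j [_ nj]; apply: F0 => w hw; apply: nj; exists w.
rewrite fsbig_image; last by move=> w w' _ _; exact: h_inj.
rewrite (fsbigE (enum W)) ?enum_uniq//; last by move=> w _; rewrite mem_enum.
rewrite big_enum_cond/=; apply: eq_bigl => w; exact: mem_set.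
Qed.

Definition embed (d : nat) (x : point d) : 'rV[int]_d := \row_j (x j)%:R.

Lemma embed_inj (d : nat) : injective (@embed d).
Proof.
move=> x y /rowP xy; apply/ffunP => j; have := xy j.
by rewrite !mxE; case: (x j) (y j) => [] [].
Qed.

Lemma cube_embed (d : nat) (x : 'rV[int]_d) :
  cube x <-> exists y, embed y = x.
Proof.
split=> [cx|[y <-] j]; last by rewrite mxE; case: (y j); [right|left].
exists [ffun j => x ord0 j == 1]; apply/rowP => j; rewrite mxE ffunE.
by case: (cx j) => ->.
Qed.

(** The nonzero increment is 1 if the base bit is 0 and -1 if it is 1. *)
Definition word_parallelepiped (d k : nat) (w : word d k) :
    'rV[int]_d * {ffun 'I_k -> 'rV[int]_d} :=
  (\row_j ((w j).1)%:R,
   [ffun i => \row_j (if (w j).2 == Some i then (-1) ^+ (w j).1 else 0)]).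

Lemma vertexE (d k : nat) (ah : 'rV[int]_d * {ffun 'I_k -> 'rV[int]_d}) e j :
  vertex ah e ord0 j = ah.1 ord0 j + \sum_(i < k) ah.2 i ord0 j *+ e i.
Proof.
by rewrite /vertex mxE summxE; congr (_ + _); apply: eq_bigr => i _; rewrite mulmxnE.
Qed.

Lemma vertex_word_parallelepiped (d k : nat) (w : word d k) e :
  vertex (word_parallelepiped w) e = embed (word_at w e).
Proof.
apply/rowP => j; rewrite vertexE !mxE !ffunE /letter_at.
under eq_bigr do rewrite ffunE mxE.
case: (w j) => b [i|] /=; last first.
  by rewrite addbF big1 ?addr0// => i _; rewrite mul0rn.
rewrite (bigD1 i)//= eqxx big1 ?addr0; first by case: b (e i) => [] [].
by move=> i' /negbTE ni; rewrite (_ : Some i == Some i' = false) ?mul0rn// eq_sym.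
Qed.

Lemma word_parallelepiped_inj (d k : nat) : injective (@word_parallelepiped d k).
Proof.
move=> w w' [/rowP aE hE]; apply/ffunP => j.
have := aE j; rewrite !mxE => bE.
have {bE} : (w j).1 = (w' j).1 by case: (w j).1 (w' j).1 bE => [] [].
have oE i : ((w j).2 == Some i) = ((w' j).2 == Some i).
  have /rowP/(_ j) := congr1 (fun h : {ffun _ -> _} => h i) hE.
  rewrite !ffunE !mxE.
  by case: eqP => _; case: eqP => _ //; case: (_.1).
move: oE; case: (w j) (w' j) => b [i|] [b' [i'|]] /= oE -> //.
- by have := oE i; rewrite eqxx => /esym/eqP->.
- by have := oE i; rewrite eqxx.
- by have := oE i'; rewrite eqxx.
Qed.

(** In a coordinate, the vertices 0, e_i and e_i + e_i' are enough to see that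
    two directions cannot both move: starting from 0 both increments would be 1,
    starting from 1 both would be -1, and the fourth vertex would leave {0,1}. *)
Lemma word_parallelepiped_surj (d k : nat) (ah : 'rV[int]_d * {ffun 'I_k -> 'rV[int]_d}) :
  (forall e, cube (vertex ah e)) -> exists w, word_parallelepiped w = ah.
Proof.
case: ah => a h cubeV.
have c0 j : a ord0 j = 0 \/ a ord0 j = 1.
  have := cubeV [ffun=> false] j; rewrite vertexE/= big1 ?addr0// => i _.
  by rewrite ffunE.
have c1 i j : a ord0 j + h i ord0 j = 0 \/ a ord0 j + h i ord0 j = 1.
  have := cubeV [ffun i' => i' == i] j; rewrite vertexE/= (bigD1 i)//= ffunE eqxx.
  by rewrite big1 ?addr0// => i' /negbTE ni; rewrite ffunE ni.
have c2 i i' j : i' != i -> a ord0 j + (h i ord0 j + h i' ord0 j) = 0 \/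
    a ord0 j + (h i ord0 j + h i' ord0 j) = 1.
  move=> ii'; have := cubeV [ffun l => (l == i) || (l == i')] j.
  rewrite vertexE/= (bigD1 i)//= (bigD1 i')//= !ffunE !eqxx orbT/=.
  rewrite big1 ?addr0// => l /andP[/negbTE li /negbTE li'].
  by rewrite ffunE li li'.
exists [ffun j => (a ord0 j == 1, [pick i | h i ord0 j != 0])].
congr (_, _).
  by apply/rowP => j; rewrite mxE ffunE/=; case: (c0 j) => ->.
apply/ffunP => i; apply/rowP => j; rewrite ffunE mxE ffunE/= -[h i 0 j]/(h i ord0 j).
case: pickP => [i' hi'|h0]; last by have /negbFE/eqP-> := h0 i.
have [[<-]|/eqP ni] := @eqP _ (Some i') (Some i).
  move/eqP: hi'; case: (c0 j) (c1 i' j) => -> /=; rewrite ?expr0 ?expr1; lia.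
have {}ni : i != i' by apply: contra ni => /eqP->.
have := c0 j; have := c1 i j; have := c1 i' j; have := c2 i' i j ni.
by move/eqP: hi'; lia.
Qed.

Lemma gowers_sum_word_sum (R : realType) (d k : nat) (f : 'rV[int]_d -> R[i]) :
  (forall x, ~ cube x -> f x = 0) ->
  gowers_sum k f = word_sum k (f \o @embed d).
Proof.
move=> f0; rewrite /gowers_sum (fsbig_inj (@word_parallelepiped_inj d k)).
  apply: eq_bigr => w _; apply: eq_bigr => e _.
  by rewrite vertex_word_parallelepiped.
move=> ah nw.
have [e ne] : exists e, ~ cube (vertex ah e).
  by apply/existsNP => /word_parallelepiped_surj[w]; exact: nw.
rewrite (bigD1 e)//= f0// -/(conj_at e 0) /conj_at.
rewrite (_ : iter _ _ _ = 0) ?mul0r//.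
by elim: (\sum_(i < k) e i)%N => //= n ->; rewrite rmorph0.
Qed.

Lemma fsbig_embed (V : nmodType) (d : nat) (F : 'rV[int]_d -> V) :
  (forall x, ~ cube x -> F x = 0) ->
  \sum_(x \in [set: 'rV[int]_d]) F x = \sum_(y : point d) F (embed y).
Proof.
move=> F0; apply: fsbig_inj (@embed_inj d) _ => x nx; apply: F0.
by move=> /cube_embed[y]; exact: nx.
Qed.

(** * The theorem *)

Lemma Re_gowers_sum_le (R : realType) (d k : nat) (p q : R)
    (f : 'rV[int]_d -> R[i]) :
  (0 < k)%N -> 0 < p -> p * q = 2 ^+ k -> 2 <= q -> 2 * k%:R + 2 <= 2 `^ q ->
  (forall x, ~ cube x -> f x = 0) ->
  0 <= complex.Re (gowers_sum k f) <=
  (\sum_(x \in [set: 'rV[int]_d]) ComplexField.Normc.normc (f x) `^ p) `^ q.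
Proof.
move=> k0 p0 pq q2 hkq f0; rewrite gowers_sum_word_sum// fsbig_embed; last first.
  by move=> x /f0->; rewrite ComplexField.Normc.normc0 powR0// gt_eqF.
by rewrite (Re_word_sum_ge0 (Ordinal k0)) (Re_word_sum_le (Ordinal k0) _ pq).
Qed.

Lemma powR_log2 (R : realType) (x : R) : 0 < x -> 2 `^ log2 x = x.
Proof.
move=> x0; rewrite /powR gt_eqF// /log2 divfK ?lnK ?posrE//.
by rewrite gt_eqF// ln_gt0// ltr1n.
Qed.

Lemma log2_ge2 (R : realType) (x : R) : 4 <= x -> 2 <= log2 x.
Proof.
move=> x4; have ln2 : 0 < ln (2 : R) by rewrite ln_gt0// ltr1n.
rewrite /log2 ler_pdivlMr// mulr_natl -lnXn// ler_ln ?posrE//; last lra.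
by apply: le_trans x4; rewrite -natrX ler_nat.
Qed.

Lemma conj_at_nat (R : realType) (k : nat) (e : point k) (n : nat) :
  conj_at e (n%:R : R[i]) = n%:R.
Proof.
by rewrite /conj_at; elim: (\sum_(i < k) e i)%N => //= m ->; rewrite conjc_nat.
Qed.

Lemma gowers_sum_indicator (R : realType) (d k : nat) (A : {fset 'rV[int]_d}) :
  (forall x, x \in A -> cube x) ->
  gowers_sum k (fun x => (x \in A)%:R : R[i]) = (parallelepipeds k A)%:R.
Proof.
move=> Acube; rewrite /gowers_sum /parallelepipeds.
set X := [set ah : _ | _].
have finX : finite_set X.
  apply: (@sub_finite_set _ _ (range (@word_parallelepiped d k))).
    move=> ah Xah; have [|w <-] := @word_parallelepiped_surj d k ah; last by exists w.
    by move=> e; apply/Acube/Xah.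
  exact/finite_image/finite_finset.
rewrite (fsbigTE (fset_set X)); last first.
  move=> ah; rewrite in_fset_set// => /negP nX.
  have [e ne] : exists e, ~ vertex ah e \in A.
    by apply/existsNP => Xah; apply: nX; rewrite inE.
  by rewrite (bigD1 e)//= -/(conj_at e _) conj_at_nat (negbTE (introN idP ne)) mul0r.
rewrite (eq_big_seq (fun=> 1)); last first.
  move=> ah /=; rewrite in_fset_set// inE => Xah; apply: big1 => e _.
  by rewrite -/(conj_at e _) conj_at_nat Xah.
by rewrite big_const_seq count_predT iter_addr_0.
Qed.

Theorem theorem1 (R : realType) (d k : nat) (hk : (2 <= k)%N) :
  (forall f : 'rV[int]_d -> R[i],
     (forall x, ~ cube x -> f x = 0) ->
     forall p : R, 0 < p -> p <= 2 ^+ k / log2 (2 * k%:R + 2) ->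
       gowers_norm k f <= lp_norm p f) /\
  (forall A : {fset 'rV[int]_d},
     (forall x, x \in A -> cube x) ->
     (parallelepipeds k A)%:R <= (#|` A|%:R : R) `^ log2 (2 * k%:R + 2)).
Proof.
have k0 : (0 < k)%N by exact: ltnW.
have K4 : 4 <= 2 * k%:R + 2 :> R by rewrite -natrM -natrD ler_nat; lia.
have := log2_ge2 K4; have := powR_log2 (lt_le_trans (ltr0n R 4) K4).
move: (log2 _) => L twoL L2.
have L0 : 0 < L by lra.
have pow0 : 0 < 2 ^+ k :> R by rewrite exprn_gt0.
split=> [f f0 p p0 pL|A Acube].
- have Lq : L <= 2 ^+ k / p by rewrite ler_pdivlMr// mulrC -ler_pdivlMr.
  have pq : p * (2 ^+ k / p) = 2 ^+ k by rewrite mulrC divfK// gt_eqF.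
  have hkq : 2 * k%:R + 2 <= 2 `^ (2 ^+ k / p).
    by rewrite -twoL ler_powR// ler1n.
  have /andP[G0 Gle] := Re_gowers_sum_le k0 p0 pq (le_trans L2 Lq) hkq f0.
  rewrite /gowers_norm /lp_norm.
  (* The exponents 1 / 2^k and q of the two norms combine into 1 / p. *)
  have -> : p^-1 = (2 ^+ k / p) * (2 ^+ k)^-1.
    by rewrite mulrAC divff ?mul1r// gt_eqF.
  by rewrite powRrM ge0_ler_powR ?nnegrE ?invr_ge0 ?powR_ge0// ltW.
(* Here q is log2 (2 k + 2), for which p = 2^k / q is the largest exponent
   allowed; on an indicator function the choice of p does not matter. *)
- pose f (x : 'rV[int]_d) : R[i] := (x \in A)%:R.
  have f0 x : ~ cube x -> f x = 0.
    by rewrite /f; case: (boolP (x \in A)) => // /Acube.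
  have p0 : 0 < 2 ^+ k / L by rewrite divr_gt0.
  have pq : 2 ^+ k / L * L = 2 ^+ k by rewrite divfK// gt_eqF.
  have hkL : 2 * k%:R + 2 <= 2 `^ L by rewrite twoL.
  have /andP[_] := Re_gowers_sum_le k0 p0 pq L2 hkL f0.
  rewrite gowers_sum_indicator//.
  rewrite (fsbigTE A); last first.
    move=> x /negbTE xA.
    by rewrite /f xA ComplexField.Normc.normc0 powR0// gt_eqF.
  rewrite (eq_big_seq (fun=> 1)) => [|x xA]; last first.
    by rewrite /f xA ComplexField.Normc.normc1 powR1.
  rewrite big_const_seq count_predT iter_addr_0.
  by rewrite -(rmorph_nat (real_complex R)).
Qed.
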